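(* Let $S$ be a finite $p$-group for an odd prime $p$. Let $\mathfrak{X}_1(S)\leq S$ be the subgroup containing $\mathfrak{X}(S)$ such that $\mathfrak{X}_1(S)/\mathfrak{X}(S)=Z(S/\mathfrak{X}(S))$. If $E$ is an elementary abelian $p$-subgroup of $S$ whose rank equals the $p$-rank of $S$ and $E\leq \mathfrak{X}_1(S)$, then $E\leq \mathfrak{X}(S)$.
   Context: For a finite $p$-group $G$ and subgroups $A,B$, write $[A,B;1]=[A,B]$ and $[A,B;k]=[[A,B;k-1],B]$. $\Omega_1(G)$ denotes the subgroup generated by the elements of order $p$ in $G$. The Oliver subgroup $\mathfrak{X}(G)$ of a finite $p$-group $G$ is the unique largest normal subgroup $K$ of $G$ admitting a chain $1=Q_0\leq Q_1\leq\cdots\leq Q_n=K$ of normal subgroups $Q_i\unlhd G$ such that $[\Omega_1(C_G(Q_{i-1})),Q_i;p-1]=1$ for each $1\leq i\leq n$. The $p$-rank of $S$ is the largest rank of an elementary abelian $p$-subgroup of $S$. *)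

(* Defs.v *)
From mathcomp Require Import all_boot all_fingroup all_solvable.
Set Implicit Arguments.
Unset Strict Implicit.
Unset Printing Implicit Defensive.
Local Open Scope group_scope.

Fixpoint iter_comm (gT : finGroupType) (A B : {set gT}) (k : nat) : {set gT} :=
  match k with
  | 0 => A
  | k'.+1 => [~: iter_comm A B k', B]
  end.

Definition Omega1 (gT : finGroupType) (p : nat) (A : {set gT}) : {set gT} :=
  <<[set x in A | #[x] == p]>>.

Definition oliver_chain (gT : finGroupType) (p : nat) (G K : {group gT}) : Prop :=
  exists (n : nat) (Q : nat -> {group gT}),
    [/\ Q 0 = 1%G, Q n = K,
        (forall i, i <= n -> Q i <| G),
        (forall i, 0 < i <= n -> Q i.-1 \subset Q i) &
        (forall i, 0 < i <= n ->
           iter_comm (Omega1 p 'C_G(Q i.-1)) (Q i) p.-1 = 1)].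

Definition is_oliver (gT : finGroupType) (p : nat) (G X : {group gT}) : Prop :=
  X <| G /\ oliver_chain p G X /\
  (forall K : {group gT}, K <| G -> oliver_chain p G K -> K \subset X).

(* Main.v *)
(* Let V be Omega_1(C_S(X)), which is central in X because C_S(X) <= X. A subgroup
   N that is central modulo X and satisfies [V, N, N] = 1 lies in X: since p > 2,
   the product X N extends an Oliver chain of X. Among the elementary abelian
   subgroups of maximal order in E V that do not centralise V, Thompson
   replacement produces one, F, with [V, F, F] = 1; then F <= X would centralise V. *)
Require Import Defs.
From mathcomp Require Import all_boot all_fingroup all_solvable.
Set Implicit Arguments.
Unset Strict Implicit.
Unset Printing Implicit Defensive.
Local Open Scope group_scope.

(** * Commutators with joins, and centres of quotients *)

Section Commutators.
Variable gT : finGroupType.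
Implicit Types (V X E F S G : {group gT}).

(** In [v, x e] = [v, e] [v, x]^e the last factor is trivial when x centralises v. *)
Lemma commg_joing_centl V X E :
  X \subset 'C(V) -> E \subset 'N(X) -> [~: V, X <*> E] \subset [~: V, E].
Proof.
move=> cVX nXE; rewrite norm_joinEr // gen_subG.
apply/subsetP=> _ /imset2P[v _ vV /mulsgP[x e xX eE ->] ->].
have /commgP/eqP cvx: commute v x by apply/esym/(centP (subsetP cVX x xX)).
by rewrite commgMJ cvx conj1g mulg1 mem_commg.
Qed.

Lemma abelem_mulg_cent p V E :
  p.-abelem V -> p.-abelem E -> E \subset 'C(V) -> p.-abelem (E * V).
Proof.
move=> abV abE cVE; have cEV : V \subset 'C(E) by rewrite centsC.
have defEV := cprodEY cEV.
by rewrite -(cprodE cEV) defEV (cprod_abelem p defEV) abE.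
Qed.

Lemma normal_commg_sub S X G :
  X \subset G -> G \subset S -> [~: G, S] \subset X -> G <| S.
Proof.
by move=> sXG sGS sX; rewrite /normal sGS -commg_subl (subset_trans sX).
Qed.

Lemma commg_cosetpre_center S X :
  X <| S -> [~: coset X @*^-1 'Z(S / X), S] \subset X.
Proof.
move=> nsXS; have nXS := normal_norm nsXS.
rewrite -quotient_cents2 ?subsetIl // cosetpreK.
exact: subsetIr.
Qed.

End Commutators.

(** * Thompson replacement *)

Section Replacement.
Variables (gT : finGroupType) (p : nat) (S V : {group gT}).
Hypotheses (pS : p.-group S) (nsVS : V <| S) (abelV : p.-abelem V).
Implicit Types (E F : {group gT}).

(** Maximality is measured by order rather than rank, since replacement compares orders of
    products. *)
Definition largest_abelem E :=
  [/\ E \subset S, p.-abelem E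
    & forall F, F \subset S -> p.-abelem F -> #|F| <= #|E|].

Lemma pnElem_rank_largest E : prime p -> E \in 'E_p^('r_p(S))(S) -> largest_abelem E.
Proof.
move=> pr_p /pnElemP[sES abE rE]; split=> // F sFS abF.
rewrite (card_pgroup (abelem_pgroup abE)) (card_pgroup (abelem_pgroup abF)) rE.
by rewrite leq_pexp2l ?prime_gt0 // logn_le_p_rank //; apply/pElemP.
Qed.

(** Sending the coset of a to [(E :&: V) :* [~ v, a]] is injective: if [v, a] and [v, b] agree
    modulo E ∩ V, then c = a b^-1 has [v, c] in E, and such a c centralises [v, E]. *)
Lemma index_cent_commg1 v E :
    v \in V -> E \subset S -> abelian E ->
  #|E : 'C_E([~: [set v], E])| <= #|[~: [set v], E] : E :&: V|.
Proof.
move=> vV sES cEE; set M := [~: _, _]; set C := 'C_E(M).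
have cVV := abelem_abelian abelV.
have nVE : E \subset 'N(V) := subset_trans sES (normal_norm nsVS).
have comV a : a \in E -> [~ v, a] \in V.
  by move=> aE; rewrite /commg groupM ?groupV ?memJ_norm ?(subsetP nVE).
(* Using [repr B] as the representative avoids a well-definedness check. *)
pose f (B : {set gT}) := (E :&: V) :* [~ v, repr B].
have rE B : B \in rcosets C E -> repr B \in E /\ B = C :* repr B.
  case/rcosetsP=> a aE ->; rewrite rcoset_repr; split=> //.
  have /rcosetP[c /setIP[cE _] ->] := mem_repr_rcoset C a.
  by rewrite groupM.
have injf : {in rcosets C E &, injective f}.
  move=> A B /rE[aE defA] /rE[bE defB]; rewrite {2}defA {2}defB /f.
  move: (repr A) (repr B) aE bE => a b aE bE {A B defA defB} eqf.
  apply/rcoset_eqP; rewrite mem_rcoset.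
  have /rcoset_eqP := eqf; rewrite mem_rcoset.
  set c := a * b^-1.
  have cE : c \in E by rewrite groupM ?groupV.
  have -> : a = c * b by rewrite mulgKV.
  have vcV := comV c cE; have vcbV : [~ v, c] ^ b \in V.
    by rewrite memJ_norm // (subsetP nVE).
  (* The quotient of the two commutators is [v, c]^b; as b is in E, so is [v, c]. *)
  rewrite commgMJ (centsP cVV _ (comV b bE) _ vcbV) mulgK => /setIP[vcbE _].
  have {vcbE} vcE : [~ v, c] \in E by rewrite memJ_norm ?(subsetP (normG E)) in vcbE.
  rewrite inE cE /=; apply/centP=> x xM.
  suff: M \subset 'C[c] by move/subsetP/(_ x xM)/cent1P.
  rewrite gen_subG; apply/subsetP=> _ /imset2P[_ d /set1P-> dE ->].
  have vdV := comV d dE.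
  (* [~ v, c] lies in E :&: V, so conjugating by c does not change [~ v, d]. *)
  have cdc : commute d c := centsP cEE d dE c cE.
  apply/cent1P/commgP/conjg_fixP.
  have /commgP/conjg_fixP dc := cdc.
  rewrite conjRg dc conjg_mulR commMgJ.
  have /commgP/eqP-> : commute [~ v, c] d := centsP cEE _ vcE d dE.
  rewrite mulg1; apply/conjg_fixP/commgP.
  exact: (centsP cVV _ vdV _ vcV).
rewrite /indexg -(card_in_imset injf).
apply/subset_leq_card/subsetP=> _ /imsetP[B /rE[bE _] ->].
apply/rcosetsP; exists [~ v, repr B] => //.
by rewrite mem_commg ?set11.
Qed.


(* Take v with [v, E, E] != 1 and M = [v, E]; then F = C_E(M) M. If F centralised
   V, comparing orders would give C_E(M) M = C_E(M) V, so [V, E] = [V, E, E] = 1. *)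
Lemma largest_abelem_replacement E :
    largest_abelem E -> ~~ ([~: V, E, E] \subset [1]) ->
  exists F, [/\ largest_abelem F, F \subset E <*> V,
    ~~ (F \subset 'C(V)) & E :&: V \proper F :&: V].
Proof.
move=> [sES abE maxE] nquad.
have cVV := abelem_abelian abelV; have cEE := abelem_abelian abE.
have [sVS nVS] := andP nsVS.
have nVE : E \subset 'N(V) := subset_trans sES nVS.
have [v vV ncvE] : exists2 v, v \in V & ~~ ([~: [set v], E] \subset 'C(E)).
  apply/exists_inP; apply: contraR nquad; rewrite negb_exists_in.
  move/forall_inP=> cVE; rewrite subG1.
  rewrite (sameP eqP commG1P) gen_subG.
  apply/subsetP=> _ /imset2P[v e vV eE ->].
  by apply: (subsetP (negbNE (cVE v vV))); rewrite mem_commg ?set11.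
have leEC := index_cent_commg1 vV sES cEE.
pose M := [~: [set v], E]%G; pose C := 'C_E(M)%G.
have sMV : M \subset V.
  by rewrite (subset_trans (commSg _ _) (_ : [~: V, E] \subset V)) ?sub1set //
     commg_subl.
have sCE : C \subset E := subsetIl _ _.
have cMC : C \subset 'C(M) := subsetIr _ _.
have abCM : p.-abelem (C * M).
  by apply: abelem_mulg_cent; rewrite ?(abelemS sMV) ?(abelemS sCE).
have defF : C * M = C <*> M by rewrite norm_joinEl // cents_norm.
(* Here |C M| |C ∩ M| = |C| |M| and |E| = |C| |E : C|; the index bound and C ∩ M <= M ∩ E ∩ V
   compare the two. *)
have leEF : #|E| <= #|C * M|.
  have leIM : #|C :&: M| <= #|M :&: (E :&: V)|.
    rewrite subset_leq_card // subsetI subsetIr setISS //.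
  rewrite -(leq_pmul2r (cardG_gt0 (C :&: M)%G)) -mul_cardG -(Lagrange sCE) -mulnA.
  rewrite leq_pmul2l ?cardG_gt0 // -(LagrangeI M (E :&: V)) mulnC.
  by apply: leq_mul.
have sEVC : E :&: V \subset C.
  by rewrite subsetI subsetIl (subset_trans _ (centS sMV)) // (subset_trans (subsetIr _ _)).
exists (C <*> M)%G; split.
- split=> [||F sFS abF] /=; last by rewrite -defF (leq_trans (maxE F sFS abF)).
    by rewrite join_subG (subset_trans sCE) // (subset_trans sMV).
  by rewrite -defF.
- exact: genS (setUSS sCE sMV).
- rewrite join_subG (subset_trans sMV cVV) andbT; apply: contra nquad => cVC.
  have abCV := abelem_mulg_cent abelV (abelemS sCE abE) cVC.
  have defCV : C * V = C <*> V by rewrite norm_joinEl // cents_norm // centsC.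
  (* C V is elementary abelian in S, so its order is at most |E| <= |C M|. *)
  have eqCV : C * M = C * V.
    apply/eqP; rewrite eqEcard mulgS //= (leq_trans _ leEF) // defCV maxE //.
      by rewrite join_subG (subset_trans sCE).
    by rewrite /= -defCV.
  have sVEM : [~: V, E] \subset [~: M, E].
    rewrite gen_subG; apply/subsetP=> _ /imset2P[w e wV eE ->].
    have: w \in C * M by rewrite eqCV (subsetP (mulG_subr _ _)).
    case/mulsgP=> c m cC mM ->.
    have /commgP/eqP ce : commute c e := centsP cEE _ (subsetP sCE c cC) e eE.
    by rewrite commMgJ ce conj1g mul1g mem_commg.
  have sMVE : M \subset [~: V, E] by rewrite commSg ?sub1set.
  have [->|ntVE] := eqVneq [~: V, E] 1; first by rewrite comm1G.
  have sVES : [~: V, E] \subset S by rewrite (subset_trans _ sVS) // commg_subl.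
  (* In a nilpotent group [W, E] is proper in W for nontrivial W normalised by E; but W = [V, E]
     satisfies W <= [M, E] <= [W, E]. *)
  have := nil_comm_properl (pgroup_nil pS) sVES ntVE (A := E).
  rewrite subsetI sES commg_normr => /(_ isT)/proper_subn/negP[].
  exact: subset_trans sVEM (commSg _ sMVE).
rewrite properE; apply/andP; split.
  by rewrite subsetI subsetIr andbT (subset_trans sEVC) ?joing_subl.
(* Otherwise M <= F ∩ V <= E with E abelian, against the choice of v. *)
apply: contra ncvE => sFE; apply: subset_trans cEE.
apply: subset_trans (subsetIl E V); apply: subset_trans sFE.
by rewrite subsetI sMV joing_subr.
Qed.

(** Each replacement strictly enlarges E ∩ V, so |V| - |E ∩ V| decreases until the action on V is
    quadratic. *)
Lemma exists_quadratic_largest_abelem E :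
    largest_abelem E -> ~~ (E \subset 'C(V)) ->
  exists F, [/\ largest_abelem F, F \subset E <*> V,
    ~~ (F \subset 'C(V)) & [~: V, F, F] \subset [1]].
Proof.
have [n] := ubnP (#|V| - #|E :&: V|); elim: n E => // n IHn E ltn lE ncE.
have [|nquad] := boolP ([~: V, E, E] \subset [1]).
  by exists E; rewrite joing_subl.
have [F [lF sFEV ncF ltEF]] := largest_abelem_replacement lE nquad.
have [|F' [lF' sF' ncF' qF']] := IHn F _ lF ncF.
  apply: leq_trans (ltn_sub2l _ (proper_card ltEF)) ltn.
  by apply: leq_trans (proper_card ltEF) _; rewrite subset_leq_card ?subsetIr.
exists F'; split=> //; apply: subset_trans sF' _.
by rewrite join_subG sFEV joing_subr.
Qed.

End Replacement.

(** * The Oliver subgroup *)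

Section Oliver.
Variables (gT : finGroupType) (p : nat).
Implicit Types (S X N K : {group gT}).

Lemma Omega1_Ohm (G : {group gT}) : prime p -> p.-group G -> Omega1 p G = 'Ohm_1(G).
Proof.
move=> pr_p pG; rewrite (OhmE 1 pG) expn1; apply/eqP; rewrite eqEsubset !gen_subG.
apply/andP; split; apply/subsetP=> x.
  rewrite inE => /andP[xG /eqP ox].
  by rewrite mem_gen // !inE xG -ox expg_order eqxx.
rewrite !inE => /andP[xG xp]; have [->|ntx] := eqVneq x 1; first exact: group1.
by rewrite mem_gen // inE xG; apply/eqP/nt_prime_order => //; apply/eqP.
Qed.

Lemma iter_comm_eq1 (A B : {set gT}) k :
  2 <= k -> [~: A, B, B] \subset [1] -> iter_comm A B k = 1.
Proof.
case: k => [|[|k]] // _; elim: k => [|k IHk] q1.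
  by apply/eqP; rewrite -subG1.
by rewrite -[iter_comm _ _ _]/[~: iter_comm A B k.+2, B] IHk // comm1G.
Qed.

Lemma oliver_chain_step S X N :
    oliver_chain p S X -> N <| S -> X \subset N ->
  iter_comm (Omega1 p 'C_S(X)) N p.-1 = 1 -> oliver_chain p S N.
Proof.
move=> [n [Q [Q0 Qn nQ sQ cQ]]] nN sXN cN.
(* N is appended at index n + 1, where the chain condition involves the previous term Q n = X. *)
exists n.+1, (fun i => if i <= n then Q i else N); rewrite Q0 ltnn; split=> // i.
- by case: ifP => // iLn _; apply: nQ.
- case/andP=> i0; rewrite leq_eqVlt => /predU1P[->|]; first by rewrite leqnn ltnn Qn.
  by rewrite ltnS => ile; rewrite ile (leq_trans (leq_pred i)) // sQ ?i0.
case/andP=> i0; rewrite leq_eqVlt => /predU1P[->|]; first by rewrite leqnn ltnn Qn.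
by rewrite ltnS => ile; rewrite ile (leq_trans (leq_pred i)) // cQ ?i0.
Qed.

Variables (S X : {group gT}).
Hypotheses (pr_p : prime p) (odd_p : odd p) (pS : p.-group S).
Hypothesis (olX : is_oliver p S X).

(** X centralises V and hence [V, N] <= V, so [V, X N, X N] <= [V, N, N] = 1 and maximality of X
    applies to X N. V stays general because it is taken both as C_S(X) and as its Omega subgroup. *)
Lemma is_oliver_quadratic_sub (V N : {group gT}) :
    Omega1 p 'C_S(X) \subset V -> X \subset 'C(V) -> N \subset S ->
    [~: N, S] \subset X -> [~: V, N] \subset V -> [~: V, N, N] \subset [1] ->
  N \subset X.
Proof.
have [nsXS [chX maxX]] := olX; have [sXS nXS] := andP nsXS.
move=> sWV cVX sNS sNSX nVN qVN; have nXN := subset_trans sNS nXS.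
have sXK : X \subset X <*> N := joing_subl X N.
have nsKS : X <*> N <| S.
  apply: (@normal_commg_sub _ S X (X <*> N)%G sXK); first by rewrite join_subG sXS.
  rewrite -quotient_cents2 ?join_subG ?normG //.
  by rewrite quotientYidl // quotient_cents2.
apply: subset_trans (joing_subr X N) _; apply: (maxX _ nsKS).
apply: (oliver_chain_step chX nsKS sXK); apply: iter_comm_eq1.
  (* An odd prime is at least 3, so p - 1 >= 2 and quadratic action suffices. *)
  by case: p pr_p odd_p => [|[|[|]]].
apply: subset_trans (commSg _ (commSg _ sWV)) _.
apply: subset_trans (commSg _ (commg_joing_centl cVX nXN)) _.
apply: subset_trans (commg_joing_centl _ nXN) qVN.
by rewrite (subset_trans cVX) // centS.
Qed.

(** Let A / Z(X) be the part of C_S(X) / Z(X) central in S / Z(X). Then [C_S(X), A] <= Z(X), which A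
    centralises, so the quadratic criterion gives A <= X and A = Z(X). *)
Lemma is_oliver_centric : 'C_S(X) \subset X.
Proof.
have [nsXS _] := olX; have [sXS nXS] := andP nsXS.
pose C := 'C_S(X)%G; pose Z := 'Z(X)%G.
have nsZS : Z <| S := gFnormal_trans _ nsXS.
have nsCS : C <| S by rewrite /normal subsetIl normsI ?normG ?norms_cent.
have sZX : Z \subset X := center_sub X.
have sZC : Z \subset C by rewrite setSI.
pose A := (coset Z @*^-1 'Z(S / Z) :&: C)%G.
have sASZ : [~: A, S] \subset Z.
  exact: subset_trans (commSg _ (subsetIl _ _)) (commg_cosetpre_center nsZS).
have sAC : A \subset C := subsetIr _ _.
have sAS : A \subset S := subset_trans sAC (subsetIl _ _).
have cAX : A \subset 'C(X) := subset_trans sAC (subsetIr _ _).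
have sCAZ : [~: C, A] \subset Z.
  by rewrite commGC (subset_trans _ sASZ) // commgS // subsetIl.
have sAX : A \subset X.
  apply: (is_oliver_quadratic_sub (V := C)) => //.
  - by rewrite Omega1_Ohm ?Ohm_sub // (pgroupS (subsetIl _ _)).
  - by rewrite centsC subsetIr.
  - exact: subset_trans sASZ sZX.
  - exact: subset_trans sCAZ sZC.
  rewrite (subset_trans (commSg _ sCAZ)) // subG1; apply/eqP/commG1P.
  by rewrite (subset_trans sZX) // centsC.
have sAZ : A \subset Z by rewrite subsetI sAX.
suff sCZ : C \subset Z by apply: subset_trans sCZ sZX.
have nZC : C \subset 'N(Z) := subset_trans (subsetIl _ _) (normal_norm nsZS).
rewrite -quotient_sub1 //; apply: contraT; rewrite subG1 => ntC.
(* A nontrivial normal subgroup of a nilpotent group meets the centre, so C / Z nontrivial would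
   make A larger than Z. *)
have := meet_center_nil (quotient_nil _ (pgroup_nil pS)) (quotient_normal Z nsCS) ntC.
case/trivgPn=> _ /setIP[/morphimP[x nZx xC ->] Zx] /negP[].
apply/eqP/coset_id/(subsetP sAZ).
by rewrite inE xC andbT; apply/morphpreP.
Qed.

End Oliver.

Theorem theorem1p2 (gT : finGroupType) (p : nat) (S X E : {group gT}) :
  prime p -> odd p -> p.-group S ->
  is_oliver p S X ->
  E \in 'E_p^('r_p(S))(S) ->
  E \subset coset X @*^-1 'Z(S / X) ->
  E \subset X.
Proof.
move=> pr_p odd_p pS olX maxE sEX1.
have [nsXS _] := olX; have [sXS nXS] := andP nsXS.
have sCX := is_oliver_centric pr_p odd_p pS olX.
have nsCS : 'C_S(X) <| S by rewrite /normal subsetIl normsI ?normG ?norms_cent.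
have pC : p.-group 'C_S(X) by rewrite (pgroupS (subsetIl _ _)).
pose V := 'Ohm_1('C_S(X))%G.
have sVC : V \subset 'C_S(X) := Ohm_sub _ _.
have nsVS : V <| S := gFnormal_trans _ nsCS.
(* C_S(X) <= X makes C_S(X) abelian. *)
have abV : p.-abelem V.
  rewrite Ohm1_abelem // /abelian.
  by apply: subset_trans (subsetIr S 'C(X)) _; apply: centS.
have cVX : X \subset 'C(V) by rewrite centsC (subset_trans sVC) ?subsetIr.
have sX1X := commg_cosetpre_center nsXS.
have quad (F : {group gT}) : F \subset S -> F \subset coset X @*^-1 'Z(S / X) ->
    [~: V, F, F] \subset [1] -> F \subset X.
  move=> sFS sFX1; apply: (is_oliver_quadratic_sub pr_p odd_p olX (V := V)) => //.
  - by rewrite Omega1_Ohm.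
  - exact: subset_trans (commSg _ sFX1) sX1X.
  by rewrite commg_subl (subset_trans sFS) ?normal_norm.
have lE := pnElem_rank_largest pr_p maxE; have [sES _ _] := lE.
have [cVE|ncVE] := boolP (E \subset 'C(V)).
  apply: quad => //; rewrite centsC in cVE; move/commG1P: cVE => ->.
  by rewrite comm1G.
have [F [lF sFEV ncF qF]] := exists_quadratic_largest_abelem pS nsVS abV lE ncVE.
(* F lies in E V and V <= C_S(X) <= X, so F is central modulo X like E; the criterion puts F in X,
   which centralises V. *)
have [sFS _ _] := lF; case/negP: ncF; rewrite (subset_trans _ cVX) // quad //.
apply: subset_trans sFEV _; rewrite join_subG sEX1.
apply: subset_trans (subset_trans sVC sCX) _; exact: sub_cosetpre.
Qed.
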